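(* Let $p>0$. For any weight $w$ on $[0,2\pi)$, $(L^w_p,\rho^w_p)$ is an $F$-space.
   Context: A weight is a Lebesgue measurable function $w:[0,2\pi)\to[0,\infty)$ with $w(t)>0$ for almost every $t$. For $p>0$, $L^w_p$ is the class of all (a.e.-equivalence classes of) complex-valued measurable functions $f$ on $[0,2\pi)$ with $$(\|f\|^w_p)^p:=\int_0^{2\pi}(\log(1+|f(t)|w(t)))^p\,\frac{dt}{2\pi}<\infty,$$ with the translation invariant metric $\rho^w_p(f,g)=(\|f-g\|^w_p)^{\min\{p,1\}}$. A vector space with a translation invariant metric is an $F$-space if the metric is complete and makes it a topological vector space. *)

(* Defs.v *)
From HB Require Import structures.
From mathcomp Require Import all_boot all_order all_algebra.
From mathcomp Require Import generic_quotient ring_quotient complex.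
From mathcomp Require Import all_classical all_reals all_analysis.
From mathcomp Require Import measurable_realfun.

Set Implicit Arguments.
Unset Strict Implicit.
Unset Printing Implicit Defensive.

Import Order.TTheory GRing.Theory Num.Theory.
Import numFieldNormedType.Exports.

Local Open Scope classical_set_scope.
Local Open Scope ring_scope.

(* The submodule [S], as a module; [HS] is a phantom argument which carries
   the closure properties used by the instances. *)
Definition sub_lmod (K : pzRingType) (V : lmodType K) (S : {pred V})
  (HS : submod_closed S) : Type := {x : V | S x}.

Section SubLmod.
Context (K : pzRingType) (V : lmodType K) (S : {pred V}).
Context (HS : submod_closed S).

HB.instance Definition _ := SubChoice.on (sub_lmod HS).
HB.instance Definition _ :=
  GRing.SubChoice_isSubLmodule.Build K V S (sub_lmod HS) HS.

End SubLmod.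

Record is_metric (R : realType) (V : Type) (d : V -> V -> R) : Prop := {
  is_metricxx : forall x, d x x = 0 ;
  is_metric_eq : forall x y, d x y = 0 -> x = y ;
  is_metric_sym : forall x y, d x y = d y x ;
  is_metric_triangle : forall y x z, d x z <= d x y + d y z }.

(* [V] equipped with the topology and the uniformity of the metric [d]. *)
Definition metrized (R : realType) (K : numFieldType) (V : lmodType K)
  (d : V -> V -> R) (Hd : is_metric d) : Type := V.

Section Metrized.
Context (R : realType) (K : numFieldType) (V : lmodType K).
Context (d : V -> V -> R) (Hd : is_metric d).

HB.instance Definition _ := GRing.Lmodule.on (metrized Hd).
HB.instance Definition _ := @isMetric.Build R (metrized Hd) d
  (is_metricxx Hd) (is_metric_eq Hd) (is_metric_sym Hd)
  (is_metric_triangle Hd).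

End Metrized.

Definition F_space (R : realType) (K : numFieldType) (V : lmodType K)
    (d : V -> V -> R) : Prop :=
  exists Hd : is_metric d,
    let E := metrized Hd in
    [/\ forall x y z : V, d (x + z) (y + z) = d x y,
        forall u : nat -> E, cauchy (u @ \oo) -> exists l : E, u @ \oo --> l,
        continuous (fun z : E * E => z.1 + z.2) &
        continuous (fun z : K^o * E => z.1 *: z.2)].

(* The real line with the sigma-algebra of the Lebesgue (not just Borel)
   measurable sets, the domain of [completed_lebesgue_measure]. *)
Definition lebR (R : realType) : Type :=
  caratheodory_type ((@wlength R idfun)^*)%mu.
HB.instance Definition _ (R : realType) := Measurable.on (lebR R).

Section LogSpaces.
Context (R : realType).

Local Notation mu := (@completed_lebesgue_measure R).

(* Functions on [0, 2pi) are represented by total functions, whose values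
   outside of [circle] play no role. *)
Definition circle : set (lebR R) := [set` `[0, 2 * pi[%R].

Lemma measurable_circle : measurable circle.
Proof.
apply: sub_caratheodory.
exact: (measurable_itv `[0, 2 * pi[).
Qed.

Definition is_weight (w : lebR R -> R) : Prop :=
  [/\ measurable_fun circle w,
      forall t, circle t -> 0 <= w t &
      {ae mu, forall t, circle t -> 0 < w t}].

Definition cmeasurable (f : lebR R -> R[i]^o) : Prop :=
  measurable_fun circle (fun t => complex.Re (f t)) /\
  measurable_fun circle (fun t => complex.Im (f t)).

Definition ae_null : {pred lebR R -> R[i]^o} :=
  fun f => `[< {ae mu, forall t, circle t -> f t = 0} >].

Lemma ae_null_zmod_closed : zmod_closed ae_null.
Proof.
split=> [|f g /asboolP f0 /asboolP g0]; apply/asboolP.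
  by apply/aeW => t _.
by apply: filterS2 f0 g0 => t + + tD => /(_ tD) ft /(_ tD) gt;
  rewrite !fctE ft gt subr0.
Qed.
HB.instance Definition _ :=
  GRing.isZmodClosed.Build (lebR R -> R[i]^o) ae_null ae_null_zmod_closed.

(* Classes, modulo equality almost everywhere on [circle], of arbitrary complex
   functions; measurability is part of the definition of [Lwp]. *)
Definition ae_class : Type := Quotient.quot (ae_null : zmodClosed _).
HB.instance Definition _ := GRing.Zmodule.on ae_class.
HB.instance Definition _ := EqQuotient.on ae_class.

Local Open Scope quotient_scope.

Definition ae_scale (a : R[i]) (c : ae_class) : ae_class :=
  \pi_ae_class (a *: repr c).

Lemma pi_aeP (f g : lebR R -> R[i]^o) :
  \pi_ae_class f = \pi_ae_class g <->
  {ae mu, forall t, circle t -> f t = g t}.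
Proof.
rewrite (rwP eqP) -Quotient.idealrBE -(rwP (asboolP _)).
split=> fg; apply: filterS fg => t + tD => /(_ tD); rewrite !fctE.
  by move/eqP; rewrite subr_eq0 => /eqP.
by move=> ->; rewrite subrr.
Qed.

Lemma ae_reprP (f : lebR R -> R[i]^o) :
  {ae mu, forall t, circle t -> repr (\pi_ae_class f) t = f t}.
Proof. by apply/pi_aeP; rewrite reprK. Qed.

Lemma pi_ae_scale a f : ae_scale a (\pi_ae_class f) = \pi_ae_class (a *: f).
Proof.
apply/pi_aeP; apply: filterS (ae_reprP f) => t + tD => /(_ tD).
by rewrite !fctE => ->.
Qed.

Lemma pi_aeD f g :
  \pi_ae_class f + \pi_ae_class g = \pi_ae_class (f + g) :> ae_class.
Proof. exact: esym (Quotient.pi_add _ _ _). Qed.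

Lemma ae_scaleA a b c : ae_scale a (ae_scale b c) = ae_scale (a * b) c.
Proof. by rewrite -[c]reprK [ae_scale b _]pi_ae_scale !pi_ae_scale scalerA. Qed.

Lemma ae_scale1 : left_id 1 ae_scale.
Proof. by move=> c; rewrite -[c]reprK pi_ae_scale scale1r. Qed.

Lemma ae_scaleDr : right_distributive ae_scale +%R.
Proof.
move=> a b c.
by rewrite -[b]reprK -[c]reprK pi_aeD !pi_ae_scale pi_aeD scalerDr.
Qed.

Lemma ae_scaleDl c : {morph ae_scale^~ c : a b / a + b}.
Proof. by move=> a b; rewrite -[c]reprK !pi_ae_scale pi_aeD scalerDl. Qed.

HB.instance Definition _ := GRing.Zmodule_isLmodule.Build R[i] ae_class
  ae_scaleA ae_scale1 ae_scaleDr ae_scaleDl.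

Definition log_int (p : R) (w : lebR R -> R) (f : lebR R -> R[i]^o) : \bar R :=
  (((2 * pi)^-1)%:E *
   \int[mu]_(t in circle) ((ln (1 + Normc.normc (f t) * w t)) `^ p)%:E)%E.

Lemma measurable_normc (f : lebR R -> R[i]^o) :
  cmeasurable f -> measurable_fun circle (fun t => Normc.normc (f t)).
Proof.
move=> [mRe mIm].
have -> : (fun t => Normc.normc (f t)) =
    Num.sqrt \o (fun t => complex.Re (f t) ^+ 2 + complex.Im (f t) ^+ 2).
  by apply/funext => t /=; case: (f t).
apply: measurableT_comp.
  exact: (continuous_measurable_fun (@sqrt_continuous R)).
by apply: measurable_funD; apply: measurable_funX.
Qed.

Lemma measurable_log_pow (p : R) (w : lebR R -> R) (g : lebR R -> R) :
  measurable_fun circle w -> measurable_fun circle g ->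
  measurable_fun circle (fun t => (ln (1 + g t * w t)) `^ p).
Proof.
move=> mw mg.
have mgw := measurable_funM mg mw.
have m1 := measurable_funD (@measurable_cst _ _ _ _ circle (1 : R)) mgw.
have ml := measurableT_comp (@measurable_ln R) m1.
exact: (measurableT_comp (measurable_powR p) ml).
Qed.

Lemma log_int_repr (p : R) w f : is_weight w -> cmeasurable f ->
  log_int p w (repr (\pi_ae_class f)) = log_int p w f.
Proof.
move=> [mw w0 _] mf; rewrite /log_int; apply: congr1.
have mF := measurable_log_pow p mw (measurable_normc mf).
move/measurable_EFinP in mF.
have FE : ae_eq mu circle
    (EFin \o (fun t => (ln (1 + Normc.normc (f t) * w t)) `^ p))
    (EFin \o (fun t =>
      (ln (1 + Normc.normc (repr (\pi_ae_class f) t) * w t)) `^ p)).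
  by apply: filterS (ae_reprP f) => t + tD => /(_ tD) /= ->.
have mG := ae_measurable_fun completed_lebesgue_measure_is_complete FE mF.
exact: (esym (ae_eq_integral _ _ measurable_circle mF mG FE)).
Qed.

Definition Lwp (p : R) (w : lebR R -> R) : {pred ae_class} :=
  fun c => `[< exists f, [/\ c = \pi_ae_class f, cmeasurable f &
                            (log_int p w f < +oo)%E] >].

(* By [log_int_repr], the value does not depend on the choice of the
   measurable representative. *)
Definition log_norm (p : R) (w : lebR R -> R) (c : ae_class) : R :=
  fine (log_int p w (repr c)) `^ p^-1.

Definition rho (p : R) (w : lebR R -> R) (HS : submod_closed (Lwp p w))
    (f g : sub_lmod HS) : R :=
  log_norm p w (val (f - g)) `^ Num.min p 1.

End LogSpaces.

(* Main.v *)
(* Write J(f) for the mean of ln(1 + |f|w)^p and q = min(p,1)/p, so that the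
   metric is J(f - g)^q. Subadditivity of x |-> ln(1 + x), combined with
   Minkowski's inequality (p >= 1) or with subadditivity of t |-> t^p (p <= 1),
   gives the triangle inequality, and also J(af) <= n^p J(f) when |a| <= n;
   J(f/n) -> 0 by dominated convergence, and scalar multiplication is then
   continuous. For completeness, extract a subsequence whose increments d_n make
   sum_n 2^(np) ln(1 + |d_n|w)^p integrable: the sum is finite a.e., so
   |d_n| w = O(2^-n) and, as w > 0 a.e., the subsequence converges a.e.; Fatou's
   lemma shows that the a.e. limit is the limit in the metric. *)
Require Import Defs.
From mathcomp Require Import all_boot all_order all_algebra complex.
From mathcomp Require Import all_classical all_reals all_analysis.
From mathcomp Require Import lra measurable_realfun.
Import Order.TTheory GRing.Theory Num.Theory.
Import numFieldNormedType.Exports.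

Set Implicit Arguments.
Unset Strict Implicit.
Unset Printing Implicit Defensive.

Local Open Scope classical_set_scope.
Local Open Scope ring_scope.

(** * Inequalities and limits for ln(1 + a) and real powers *)

Section RealInequalities.
Context {R : realType}.
Implicit Types a b p q : R.

Lemma ler_ln1D a b : 0 <= a -> a <= b -> ln (1 + a) <= ln (1 + b).
Proof. by move=> a0 ab; rewrite ler_ln ?posrE; lra. Qed.

Lemma ln1D_ge0 a : 0 <= a -> 0 <= ln (1 + a).
Proof. by move=> a0; rewrite ln_ge0//; lra. Qed.

(** The product (1 + a)(1 + b) exceeds 1 + (a + b) by ab >= 0. *)
Lemma ln1D_subadd a b : 0 <= a -> 0 <= b ->
  ln (1 + (a + b)) <= ln (1 + a) + ln (1 + b).
Proof. by move=> a0 b0; rewrite -lnM ?posrE ?ler_ln ?posrE; nra. Qed.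

Lemma ln1D_mulrn a n : 0 <= a -> ln (1 + a *+ n) <= ln (1 + a) *+ n.
Proof.
move=> a0; elim: n => [|n IH]; first by rewrite !mulr0n addr0 ln1.
by rewrite !mulrS (le_trans (ln1D_subadd _ _)) ?mulrn_wge0// lerD2l.
Qed.

(** With l = ln(1 + a), the bound 1 - l <= e^(-l) times 1 + a = e^l gives a <= l e^l. It turns
    geometric decay of bounded logarithms into geometric decay of their arguments. *)
Lemma le_expR_ln1D a b : 0 <= a -> ln (1 + a) <= b -> a <= ln (1 + a) * expR b.
Proof.
move=> a0; set l := ln (1 + a) => lb.
have el : expR l = 1 + a by rewrite lnK// posrE; lra.
have l0 : 0 <= l := ln1D_ge0 a0.
apply: (@le_trans _ _ (l * expR l)); last by rewrite ler_wpM2l// ler_expR.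
have := expR_ge1Dx (- l); rewrite expRN el => /(ler_wpM2r (_ : 0 <= 1 + a)).
by rewrite mulVf; [move=> /(_ ltac:(lra)); lra|lra].
Qed.

Lemma powR_subadd p a b : 0 < p <= 1 -> 0 <= a -> 0 <= b ->
  (a + b) `^ p <= a `^ p + b `^ p.
Proof.
move=> /andP[p0 p1] a0 b0.
have [s0|sn0] := eqVneq (a + b) 0.
  by rewrite s0 powR0 ?gt_eqF// addr_ge0 ?powR_ge0.
have s0 : 0 < a + b by rewrite lt_neqAle eq_sym sn0 addr_ge0.
(* For x / (a + b) in [0, 1] and p <= 1, x / (a + b) <= (x / (a + b))^p. Adding the cases x = a and
   x = b, whose weights sum to 1, gives the claim. *)
have H x : 0 <= x -> x <= a + b -> x / (a + b) * (a + b) `^ p <= x `^ p.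
  rewrite le_eqVlt => /predU1P[<- _|x0 xab].
    by rewrite mul0r mul0r powR_ge0.
  rewrite -{2}(divfK sn0 x) powRM ?divr_ge0 ?(ltW x0) ?(ltW s0)//.
  rewrite ler_wpM2r ?powR_ge0// ger1_powR ?divr_gt0//=.
  by rewrite ler_pdivrMr// mul1r.
have -> : (a + b) `^ p = a / (a + b) * (a + b) `^ p + b / (a + b) * (a + b) `^ p.
  by rewrite -!mulrDl mulfV// mul1r.
by rewrite lerD// H// ?lerDl ?lerDr.
Qed.

Lemma cvg_powR (u : nat -> R) a p : 0 < p -> (forall n, 0 <= u n) ->
  u @ \oo --> a -> u n `^ p @[n --> \oo] --> a `^ p.
Proof.
move=> p0 u0 ua.
have : 0 <= a by apply: (cvgr_to_ge ua); exact: nearW.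
rewrite le_eqVlt => /predU1P[a0|a0].
  rewrite -a0 powR0 ?gt_eqF//; apply/cvgr0Pnorm_lt => e e0.
  have d0 : 0 < e `^ p^-1 by rewrite powR_gt0.
  move: ua; rewrite -a0 => /cvgr0Pnorm_lt/(_ _ d0); apply: filterS => n.
  rewrite !ger0_norm ?powR_ge0// => und.
  have -> : e = (e `^ p^-1) `^ p by rewrite -powRrM mulVf ?gt_eqF// powRr1// ltW.
  by rewrite gt0_ltr_powR ?nnegrE// ltW.
rewrite /powR (gt_eqF a0).
have lu := cvg_comp _ _ ua (continuous_ln a0).
have pu : p * ln (u n) @[n --> \oo] --> p * ln a by exact: (cvgMl_tmp lu).
have ex := cvg_comp _ _ pu (@continuous_expR R _).
apply: cvg_trans; last exact: ex.
apply: near_eq_cvg => /=.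
near=> n; rewrite gt_eqF//; near: n; exact: cvgr_gt ua _ a0.
Unshelve. all: by end_near. Qed.

End RealInequalities.

(** * Integrals of p-th powers and the triangle inequality *)

Section PowerIntegral.
Context d (T : measurableType d) (R : realType).
Variables (mu : {measure set T -> \bar R}) (D : set T) (p : R).
Hypotheses (mD : measurable D) (p0 : 0 < p).
Implicit Types u v : T -> R.

Local Notation q := (p^-1 * Num.min p 1)%R.
Local Notation I u := (\int[mu]_(t in D) (u t `^ p)%:E)%E.

Lemma powR_integral_ge0 u : (0 <= I u)%E.
Proof. by apply: integral_ge0 => t _; rewrite lee_fin powR_ge0. Qed.

Lemma measurable_powR_EFin u : measurable_fun D u ->
  measurable_fun D (fun t => (u t `^ p)%:E).
Proof. by move=> fu; apply/measurable_EFinP; exact: (measurableT_comp (measurable_powR p) fu). Qed.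

(** Extending [u] by 0 off [D] turns the integral into one over the whole space, since 0^p = 0 for p
    > 0; this is the form to which Minkowski's inequality applies. *)
Lemma powR_integral_Lnorm u : (forall t, D t -> 0 <= u t) ->
  (I u `^ p^-1 = 'N[mu]_p%:E [EFin \o (u \_ D)])%E.
Proof.
move=> u0; rewrite Lnorm.unlock; congr (_ `^ _)%E.
rewrite integral_mkcond; apply: eq_integral => t _ /=.
rewrite /patch; case: ifPn => [/[!inE] tD|_]; last by rewrite normr0 powR0 ?gt_eqF.
by rewrite ger0_norm ?u0.
Qed.

(* For p >= 1 this is Minkowski's inequality; for p <= 1, the exponent is 1 and
   t |-> t^p is subadditive. *)
Lemma powR_integral_subadd u v :
  measurable_fun D u -> measurable_fun D v ->
  (forall t, D t -> 0 <= u t) -> (forall t, D t -> 0 <= v t) ->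
  (I (u \+ v)%R `^ q <= I u `^ q + I v `^ q)%E.
Proof.
move=> fu mv u0 v0; have [p1|/ltW p1] := leP p 1.
  rewrite mulVf ?gt_eqF// !poweRe1 ?powR_integral_ge0//.
  rewrite -ge0_integralD//; try by [move=> t _; rewrite lee_fin powR_ge0|
    exact: measurable_powR_EFin].
  apply: ge0_le_integral => //.
  - by move=> t _; rewrite lee_fin powR_ge0.
  - exact/measurable_powR_EFin/measurable_funD.
  - by apply: emeasurable_funD; exact: measurable_powR_EFin.
  - by move=> t tD; rewrite -EFinD lee_fin powR_subadd ?p0 ?u0 ?v0.
rewrite mulr1 !powR_integral_Lnorm//; last first.
  by move=> t tD; rewrite addr_ge0 ?u0 ?v0.
have -> : (u \+ v) \_ D = (u \_ D) \+ (v \_ D).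
  by apply/funext => t /=; rewrite /patch; case: ifP => // _; rewrite addr0.
by apply: minkowski_EFin => //; apply/(measurable_restrictT _ mD).1.
Qed.

End PowerIntegral.

(** * The complex modulus and convergence of sequences *)

Section ComplexSequences.
Context {R : realType}.
Implicit Types (z : nat -> R[i]) (a l : R[i]) (u : nat -> R).

Lemma normc_ge0 a : 0 <= Normc.normc a.
Proof. by case: a => x y; exact: sqrtr_ge0. Qed.

Lemma normc_ge_Re_Im a :
  `|complex.Re a| <= Normc.normc a /\ `|complex.Im a| <= Normc.normc a.
Proof.
case: a => x y /=; split.
- by rewrite -sqrtr_sqr ler_wsqrtr// lerDl sqr_ge0.
- by rewrite -sqrtr_sqr ler_wsqrtr// lerDr sqr_ge0.
Qed.

Lemma normc_le_ReIm a : Normc.normc a <= `|complex.Re a| + `|complex.Im a|.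
Proof.
case: a => x y /=; rewrite -[leRHS]ger0_norm ?addr_ge0// -sqrtr_sqr.
by rewrite ler_wsqrtr// sqrrD !real_normK ?num_real// lerD2r lerDl mulrn_wge0 ?mulr_ge0.
Qed.

Lemma normcD_le a b : Normc.normc (a + b) <= Normc.normc a + Normc.normc b.
Proof. exact: le_normcD. Qed.

Lemma cvg_normc z l : Normc.normc (z n - l) @[n --> \oo] --> (0 : R) ->
  Normc.normc (z n) @[n --> \oo] --> Normc.normc l.
Proof.
move=> zl; apply/cvgrPdist_lt => e e0.
have /cvgr0Pnorm_lt/(_ _ e0) := zl; apply: filterS => n.
rewrite ger0_norm ?normc_ge0//; apply: le_lt_trans.
have H1 : Normc.normc (z n) <= Normc.normc (z n - l) + Normc.normc l.
  by rewrite -{1}(subrK l (z n)) normcD_le.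
have H2 : Normc.normc l <= Normc.normc (z n - l) + Normc.normc (z n).
  have -> : Normc.normc (z n - l) = Normc.normc (l - z n).
    by rewrite -opprB normcN.
  by rewrite -{1}(subrK (z n) l) normcD_le.
by rewrite ler_norml; apply/andP; split; lra.
Qed.

(** Pointwise convergence of the integrands, as needed for dominated convergence and Fatou's
    lemma. *)
Lemma cvg_powR_ln1D_normc z l (p W : R) : 0 < p -> 0 <= W ->
  Normc.normc (z n - l) @[n --> \oo] --> (0 : R) ->
  ln (1 + Normc.normc (z n) * W) `^ p @[n --> \oo] -->
  ln (1 + Normc.normc l * W) `^ p.
Proof.
move=> p0 W0 /cvg_normc zl; apply: cvg_powR => // [n|].
  by rewrite ln1D_ge0 ?mulr_ge0 ?normc_ge0.
have l0 : 0 < 1 + Normc.normc l * W by rewrite ltr_pwDl ?mulr_ge0 ?normc_ge0.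
have H : 1 + Normc.normc (z n) * W @[n --> \oo] --> 1 + Normc.normc l * W.
  by apply: cvgD; [exact: cvg_cst|exact: cvgMr_tmp].
exact: (cvg_comp _ _ H (continuous_ln l0)).
Qed.

(** The sequence is its first term plus a telescoping series, which is dominated by a geometric
    one. *)
Lemma cvg_geometric_increments u (K : R) :
  (forall n, `|u n.+1 - u n| <= K * (1 / 2) ^+ n) -> cvgn u.
Proof.
move=> uK.
have cs : cvgn (series (telescope u)).
  apply: normed_cvg.
  apply: (@series_le_cvg _ _ (geometric K (1 / 2))) => [n|n|n|].
  - exact: normr_ge0.
  - by apply: le_trans (uK n).
  - exact: uK.
  - by apply: is_cvg_geometric_series; rewrite ger0_norm; lra.
have -> : u = (fun n => u 0%N + series (telescope u) n).
  by apply/funext => n; exact: eq_sum_telescope.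
by apply: is_cvgD => //; exact: is_cvg_cst.
Qed.

(** A limsup is measurable without any convergence assumption; this recovers the true limit at the
    points where there is one. *)
Lemma fine_limn_esup u (l : R) : u n @[n --> \oo] --> l ->
  fine (limn_esup (fun n => (u n)%:E)) = l.
Proof.
move=> ul.
have H : (fun n => (u n)%:E) @ \oo --> l%:E by apply: cvg_EFin => //; exact: nearW.
by rewrite (cvg_limn_einf_sup H).
Qed.

End ComplexSequences.

(** * The functional J on measurable functions: basic estimates *)

Section LogIntegral.
Context {R : realType} {p : R} (p0 : 0 < p) {w : lebR R -> R} (hw : is_weight w).
Implicit Types (f g : lebR R -> R[i]^o) (a : R[i]).

Local Open Scope quotient_scope.
Local Notation mu := (@completed_lebesgue_measure R).
Local Notation D := (@circle R).
Local Notation q := (p^-1 * Num.min p 1).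
Local Notation J := (log_int p w).
Local Notation ell f := (fun t => ln (1 + Normc.normc (f t) * w t)).

Let q0 : 0 < q. Proof. by rewrite mulr_gt0 ?invr_gt0// lt_min p0 ltr01. Qed.

Lemma cmeasurable_cst0 : cmeasurable (0 : lebR R -> R[i]^o).
Proof. by split; exact: measurable_cst. Qed.

Lemma cmeasurableD f g : cmeasurable f -> cmeasurable g -> cmeasurable (f + g).
Proof.
move=> [fR fI] [gR gI]; split.
- rewrite (_ : (fun t => _) = (fun t => complex.Re (f t) + complex.Re (g t))).
    exact: measurable_funD.
  by apply/funext => t; rewrite fctE; case: (f t) (g t) => ? ? [].
- rewrite (_ : (fun t => _) = (fun t => complex.Im (f t) + complex.Im (g t))).
    exact: measurable_funD.
  by apply/funext => t; rewrite fctE; case: (f t) (g t) => ? ? [].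
Qed.

Lemma cmeasurableZ a f : cmeasurable f -> cmeasurable (a *: f).
Proof.
move=> [fR fI]; case: a => x y; split.
- rewrite (_ : (fun t => _) =
    (fun t => x * complex.Re (f t) - y * complex.Im (f t))).
    by apply: measurable_funB; exact: measurable_funM.
  by apply/funext => t; rewrite fctE; case: (f t).
- rewrite (_ : (fun t => _) =
    (fun t => x * complex.Im (f t) + y * complex.Re (f t))).
    by apply: measurable_funD; exact: measurable_funM.
  by apply/funext => t; rewrite fctE; case: (f t).
Qed.

Lemma cmeasurableB f g : cmeasurable f -> cmeasurable g -> cmeasurable (f - g).
Proof.
by move=> mf mg; rewrite -scaleN1r; apply/cmeasurableD/cmeasurableZ.
Qed.

Lemma weight_ge0 t : circle t -> 0 <= w t.
Proof. by case: hw => _ + _; exact. Qed.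

Lemma ell_ge0 f t : circle t -> 0 <= ell f t.
Proof. by move=> tD; rewrite ln1D_ge0 ?mulr_ge0 ?normc_ge0 ?weight_ge0. Qed.

Lemma measurable_ell f : cmeasurable f -> measurable_fun D (ell f).
Proof.
move=> mf; case: hw => mw _ _; apply: (measurableT_comp (@measurable_ln R)).
apply: measurable_funD; first exact: measurable_cst.
exact: measurable_funM (measurable_normc mf) mw.
Qed.

Lemma measurable_ell_pow f : cmeasurable f ->
  measurable_fun D (fun t => (ell f t `^ p)%:E).
Proof. by move=> mf; exact/measurable_powR_EFin/measurable_ell. Qed.

Lemma log_int_ge0 f : (0 <= J f)%E.
Proof.
by rewrite mule_ge0 ?powR_integral_ge0// lee_fin invr_ge0 mulr_ge0 ?pi_ge0.
Qed.

Lemma log_int_le f (v : lebR R -> R) :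
  cmeasurable f -> measurable_fun D v ->
  (forall t, circle t -> ell f t <= v t) ->
  (J f <= ((2 * pi)^-1)%:E * \int[mu]_(t in D) (v t `^ p)%:E)%E.
Proof.
move=> mf mv fv; rewrite lee_wpmul2l ?lee_fin ?invr_ge0 ?mulr_ge0 ?pi_ge0//.
apply: ge0_le_integral; [exact: measurable_circle|..].
- by move=> t _; rewrite lee_fin powR_ge0.
- exact: measurable_ell_pow.
- exact: measurable_powR_EFin.
- move=> t tD; have f0 := ell_ge0 f tD; have fvt := fv t tD.
  by rewrite lee_fin (ge0_ler_powR (ltW p0))// nnegrE// (le_trans f0 fvt).
Qed.

Lemma log_int_mono f g : cmeasurable f -> cmeasurable g ->
  (forall t, circle t -> Normc.normc (f t) <= Normc.normc (g t)) ->
  (J f <= J g)%E.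
Proof.
move=> mf mg fg; apply: log_int_le => //; first exact: measurable_ell.
move=> t tD; rewrite ler_ln1D ?mulr_ge0 ?normc_ge0 ?weight_ge0//.
by rewrite ler_wpM2r ?weight_ge0 ?fg.
Qed.

(** Pointwise, ln(1 + |f + g|w) <= ln(1 + |f|w) + ln(1 + |g|w); the L^p-type inequality
    [powR_integral_subadd] does the rest. *)
Lemma log_intD_le f g : cmeasurable f -> cmeasurable g ->
  (J (f + g)%R `^ q <= J f `^ q + J g `^ q)%E.
Proof.
move=> mf mg; have c0 : (0 <= ((2 * pi)^-1 : R)%:E)%E.
  by rewrite lee_fin invr_ge0 mulr_ge0 ?pi_ge0.
apply: (@le_trans _ _ ((((2 * pi)^-1)%:E *
    \int[mu]_(t in D) ((ell f \+ ell g) t `^ p)%:E) `^ q)%E).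
  apply: gt0_ler_poweR; first exact: ltW.
  - by rewrite in_itv/= leey log_int_ge0.
  - by rewrite in_itv/= leey mule_ge0 ?powR_integral_ge0.
  apply: log_int_le; first exact: cmeasurableD.
    by apply: measurable_funD; exact: measurable_ell.
  move=> t tD /=; apply: le_trans (ln1D_subadd _ _);
    rewrite ?mulr_ge0 ?normc_ge0 ?weight_ge0//.
  rewrite ler_ln1D ?mulr_ge0 ?normc_ge0 ?weight_ge0// -mulrDl.
  by rewrite ler_wpM2r ?weight_ge0// normcD_le.
have := powR_integral_subadd mu (@measurable_circle R) p0 (measurable_ell mf)
  (measurable_ell mg) (fun t => @ell_ge0 f t) (fun t => @ell_ge0 g t).
rewrite /log_int.
have := powR_integral_ge0 mu D p (ell f \+ ell g).
have := powR_integral_ge0 mu D p (ell f).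
have := powR_integral_ge0 mu D p (ell g).
move: (integral _ _ _) (integral _ _ _) (integral _ _ _) => A B C A0 B0 C0 CBA.
(* The normalising constant 1/(2 pi) contributes the same factor, its q-th power, to all three
   terms. *)
rewrite (poweRM q c0 A0) (poweRM q c0 B0) (poweRM q c0 C0).
rewrite -ge0_muleDr ?poweR_ge0//.
by rewrite lee_wpmul2l ?poweR_ge0.
Qed.

(** Since |a| <= n, subadditivity applied n times gives ln(1 + |a f|w) <= n ln(1 + |f|w). *)
Lemma log_intZ_le a n f : Normc.normc a <= n%:R -> cmeasurable f ->
  (J (a *: f)%R <= (n%:R `^ p)%:E * J f)%E.
Proof.
move=> an mf.
have mf' := measurable_ell mf.
apply: le_trans (log_int_le (v := n%:R \*o ell f) _ _ _) _.
- exact: cmeasurableZ.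
- exact: measurable_funM.
- move=> t tD /=; rewrite mulr_natl.
  apply: le_trans (ln1D_mulrn _ _); last first.
    by rewrite mulr_ge0 ?normc_ge0 ?weight_ge0.
  rewrite ler_ln1D ?mulr_ge0 ?normc_ge0 ?weight_ge0// -mulrnAl.
  by rewrite ler_wpM2r ?weight_ge0// Normc.normcM -mulr_natl ler_wpM2r ?normc_ge0.
- rewrite muleCA lee_wpmul2l ?lee_fin ?invr_ge0 ?mulr_ge0 ?pi_ge0//.
  rewrite -ge0_integralZl_EFin; first last.
  - exact: powR_ge0.
  - exact: measurable_ell_pow.
  - by move=> t _; rewrite lee_fin powR_ge0.
  - exact: measurable_circle.
  rewrite (eq_integral (fun t => ((n%:R `^ p)%:E * (ell f t `^ p)%:E)%E))//.
  by move=> t /[!inE] tD; rewrite -EFinM powRM ?ell_ge0.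
Qed.

Lemma log_int0 : J 0 = 0%E.
Proof.
rewrite /log_int integral0_eq ?mule0// => t _.
by rewrite [Normc.normc _]Normc.normc0 mul0r addr0 ln1 powR0 ?gt_eqF.
Qed.

Lemma log_intN f : J (- f) = J f.
Proof.
apply: (congr1 (mule _)); apply: eq_integral => t _.
by rewrite [Normc.normc _]normcN.
Qed.

(** The integrand vanishes a.e., hence so does |f|w, and w > 0 a.e. then forces f = 0. *)
Lemma log_int_eq0 f : cmeasurable f -> J f = 0%E ->
  {ae mu, forall t, circle t -> f t = 0}.
Proof.
move=> mf /eqP; rewrite mule_eq0 eqe invr_eq0 mulf_eq0 pnatr_eq0/= gt_eqF ?pi_gt0//=.
move=> /eqP If; case: hw => _ _ w0.
have : (\int[mu]_(t in D) `|(ell f t `^ p)%:E| = 0)%E.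
  rewrite -If; apply: eq_integral => t _.
  by rewrite gee0_abs// lee_fin powR_ge0.
move/(ae_eq_integral_abs mu (@measurable_circle R) (measurable_ell_pow mf)).
move=> fz; apply: filterS2 fz w0 => t + + tD => /(_ tD) [+] /(_ tD) wt.
move/powR_eq0_eq0/eqP; rewrite ln_eq0; last first.
  by rewrite ltr_pwDl// mulr_ge0 ?normc_ge0// ltW.
rewrite addrC -subr_eq0 addrK mulf_eq0 (gt_eqF wt) orbF => /eqP.
exact: Normc.eq0_normc.
Qed.

(** * Limit theorems for J and completeness at the level of functions *)

Lemma log_int_scale_cvg0 f : cmeasurable f -> (J f < +oo)%E ->
  J ((n.+1%:R^-1)%:C%C *: f) @[n --> \oo] --> 0%E.
Proof.
move=> mf Jf; pose s n : lebR R -> R[i]^o := (n.+1%:R^-1)%:C%C *: f.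
have ms n : cmeasurable (s n) by exact: cmeasurableZ.
have sn t n : Normc.normc (s n t) = n.+1%:R^-1 * Normc.normc (f t).
  have -> : s n t = (n.+1%:R^-1)%:C%C * f t :> R[i] by [].
  rewrite Normc.normcM; congr (_ * _).
  by rewrite /= expr0n/= addr0 sqrtr_sqr ger0_norm.
have c0 : 0 < (2 * pi)^-1 :> R by rewrite invr_gt0 mulr_gt0 ?pi_gt0.
have If : mu.-integrable D (fun t => (ell f t `^ p)%:E).
  apply/integrableP; split; first exact: measurable_ell_pow.
  rewrite (eq_integral (fun t => (ell f t `^ p)%:E)); last first.
    by move=> t _; rewrite gee0_abs// lee_fin powR_ge0.
  (* An infinite integral would stay infinite after multiplication by 1/(2 pi) > 0. *)
  move: Jf (powR_integral_ge0 mu D p (ell f)); rewrite /log_int.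
  by case: (integral _ _ _) => [r _ _|+ _|//]; rewrite ?ltry// gt0_muley ?lte_fin.
(* The integrand of f dominates, because 1/(n+1) <= 1, and the scaled integrands tend to 0 at every
   point of the circle. *)
have [|||||_ _] := @dominated_convergence _ _ _ mu D (@measurable_circle R)
    (fun n t => (ell (s n) t `^ p)%:E) (fun=> 0%E) (fun t => (ell f t `^ p)%:E).
- by move=> n; exact: measurable_ell_pow.
- exact: measurable_cst.
- apply: aeW => t tD; apply: cvg_EFin; first exact: nearW.
  have s0 : Normc.normc (s n t - 0) @[n --> \oo] --> (0 : R).
    under eq_fun do rewrite subr0 sn.
    have := cvgMr_tmp (b := Normc.normc (f t)) (@cvg_harmonic R).
    by rewrite mul0r; apply.
  have := cvg_powR_ln1D_normc p0 (weight_ge0 tD) s0.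
  by rewrite Normc.normc0 mul0r addr0 ln1 powR0 ?gt_eqF.
- exact: If.
- apply: aeW => t n tD; rewrite gee0_abs ?lee_fin ?powR_ge0//.
  apply: (ge0_ler_powR (ltW p0)); rewrite ?nnegrE ?ell_ge0//.
  rewrite ler_ln1D ?mulr_ge0 ?normc_ge0 ?weight_ge0// ler_wpM2r ?weight_ge0//.
  by rewrite sn ler_piMl ?normc_ge0// invf_le1// ler1n.
- rewrite integral0 => /(cvgeZl (_ : ((2 * pi)^-1)%:E \is a fin_num)).
  by rewrite mule0; apply.
Qed.

Lemma log_int_fatou (f_ : nat -> lebR R -> R[i]^o) f (B : R) :
  (forall n, cmeasurable (f_ n)) -> cmeasurable f ->
  {ae mu, forall t, D t ->
    Normc.normc (f_ n t - f t) @[n --> \oo] --> (0 : R)} ->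
  (forall n, (J (f_ n) <= B%:E)%E) -> (J f <= B%:E)%E.
Proof.
move=> mf_ mf f_f JB.
have c0 : 0 < 2 * pi :> R by rewrite mulr_gt0 ?pi_gt0.
have mF n : measurable_fun D (fun t => (ell (f_ n) t `^ p)%:E).
  exact: measurable_ell_pow.
rewrite /log_int lee_pdivrMl//.
(* The integrand of f agrees a.e. with the liminf of the integrands of [f_ n], to which Fatou's
   lemma applies. *)
rewrite (@ge0_ae_eq_integral _ _ _ mu D _
  (fun t => limn_einf (fun n => (ell (f_ n) t `^ p)%:E))).
- have F0 n t : D t -> (0 <= (ell (f_ n) t `^ p)%:E)%E.
    by rewrite lee_fin powR_ge0.
  apply: (le_trans (fatou mu (@measurable_circle R) mF F0)).
  rewrite limn_einf_lim; apply: lime_le; first exact: is_cvg_einfs.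
  apply: nearW => n; apply: (@le_trans _ _
      (\int[mu]_(t in D) (ell (f_ n) t `^ p)%:E)%E).
    by apply: ereal_inf_lbound; exists n => /=.
  by rewrite -lee_pdivrMl//; exact: JB.
- exact: measurable_circle.
- exact: measurable_ell_pow.
(* The liminf is measurable as minus the limsup of the opposites. *)
- apply: (measurableT_comp (@oppe_measurable R setT)).
  apply: measurable_fun_limn_esup => n.
  exact: (measurableT_comp (@oppe_measurable R setT) (mF n)).
- by move=> t _; rewrite lee_fin powR_ge0.
- move=> t _; rewrite limn_einf_lim; apply: lime_ge; first exact: is_cvg_einfs.
  by apply: nearW => n; apply: le_ereal_inf_tmp => _ [k _ <-]; rewrite lee_fin powR_ge0.
- apply: filterS f_f => t + tD => /(_ tD)/(cvg_powR_ln1D_normc p0 (weight_ge0 tD)).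
  move=> ft.
  have H : (fun n => (ell (f_ n) t `^ p)%:E) @ \oo --> (ell f t `^ p)%:E.
    by apply: cvg_EFin => //; exact: nearW.
  by rewrite (cvg_limn_einf_sup H).
Qed.

Lemma log_int_fast_cauchy_cvg (f_ : nat -> lebR R -> R[i]^o) :
  (forall n, cmeasurable (f_ n)) ->
  (forall n, (J (f_ n.+1 - f_ n)%R <=
    (((1 / 2) ^+ n) `^ p * (1 / 2) ^+ n.+1)%:E)%E) ->
  exists2 f : lebR R -> R[i]^o, cmeasurable f &
    {ae mu, forall t, D t ->
      Normc.normc (f_ n t - f t) @[n --> \oo] --> (0 : R)}.
Proof.
move=> mf_ fJ.
have c0 : 0 < 2 * pi :> R by rewrite mulr_gt0 ?pi_gt0.
have h0 n : 0 < (1 / 2) ^+ n :> R by rewrite exprn_gt0//; lra.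
(* The weight [b n] is 2^(np): large enough to force geometric decay of the increments where [S] is
   finite, yet exactly compensated by the hypothesis. *)
pose b n : R := (((1 / 2) ^+ n) `^ p)^-1.
have b0 n : 0 < b n by rewrite invr_gt0 powR_gt0.
pose d n : lebR R -> R[i]^o := f_ n.+1 - f_ n.
have md n : cmeasurable (d n) by exact: cmeasurableB.
pose F n t := ((b n)%:E * (ell (d n) t `^ p)%:E)%E.
have F0 n t : (0 <= F n t)%E by rewrite mule_ge0 ?lee_fin ?powR_ge0// ltW.
have mF n : measurable_fun D (F n).
  by apply: measurable_funeM; exact: measurable_ell_pow.
pose S t := (\sum_(n <oo) F n t)%E.
have S0 t : (0 <= S t)%E by apply: nneseries_ge0.
have mS : measurable_fun D S.
  by apply: (ge0_emeasurable_sum (P := xpredT)) => // n t _ _; exact: F0.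
have IS : mu.-integrable D S.
  apply/integrableP; split => //.
  rewrite (eq_integral S); last by move=> t _; rewrite gee0_abs.
  rewrite (integral_nneseries mu (@measurable_circle R) mF)//.
  (* The factor [b n] cancels 2^(-np) in the hypothesis; what remains is 2 pi / 2^(n+1), with sum at
     most 2 pi. *)
  apply: (@le_lt_trans _ _ (\sum_(n <oo) ((2 * pi) / (2 ^ n.+1)%:R)%:E)%E).
    apply: lee_nneseries => [n _ _|n _]; first exact: integral_ge0.
    have := fJ n; rewrite /log_int lee_pdivrMl// => Hn.
    rewrite ge0_integralZl_EFin; first last.
    - exact: ltW.
    - exact: measurable_ell_pow.
    - by move=> t _; rewrite lee_fin powR_ge0.
    - exact: measurable_circle.
    apply: (le_trans (lee_wpmul2l _ Hn)); first by rewrite lee_fin ltW.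
    rewrite [leLHS](_ : _ = (b n * (2 * pi *
      (((1 / 2) ^+ n) `^ p * (1 / 2) ^+ n.+1)))%:E)// lee_fin natrX /b mulrCA mulKf ?gt_eqF ?powR_gt0//.
    by rewrite expr_div_n expr1n div1r.
  by rewrite (le_lt_trans (epsilon_trick0 _ _)) ?ltry// ltW.
(* As [F n t <= S t], taking p-th roots gives ln(1 + |d_n|w) <= C 2^(-n) with C = S(t)^(1/p). In
   particular it is at most C, so [le_expR_ln1D] yields |d_n|w <= C e^C 2^(-n), and dividing by w(t)
   > 0 gives K. *)
have incr t : D t -> 0 < w t -> S t \is a fin_num ->
    exists K : R, forall n, Normc.normc (d n t) <= K * (1 / 2) ^+ n.
  move=> tD wt Sfin; pose C := fine (S t) `^ p^-1.
  have C0 : 0 <= C by exact: powR_ge0.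
  have ellC n : ell (d n) t <= C * (1 / 2) ^+ n.
    have : (F n t <= S t)%E.
      (* A partial sum of [n.+1] terms is the first to contain the term of index n. *)
      apply: le_trans (nneseries_lim_ge n.+1 (fun k _ _ => F0 k t)).
      rewrite big_nat_recr//= leeDr// sume_ge0//.
    rewrite -(fineK Sfin) /F -EFinM lee_fin /b ler_pdivrMl ?powR_gt0// => H.
    have l0 := ell_ge0 (d n) tD.
    have -> : ell (d n) t = (ell (d n) t `^ p) `^ p^-1.
      by rewrite -powRrM mulfV ?gt_eqF// powRr1.
    have h2 : 0 <= ((1 / 2) ^+ n) `^ p * fine (S t).
      by rewrite mulr_ge0 ?powR_ge0 ?fine_ge0.
    have ip0 : 0 <= p^-1 by rewrite invr_ge0 ltW.
    apply: (le_trans (ge0_ler_powR ip0 _ _ H)); rewrite ?nnegrE ?powR_ge0//.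
    rewrite powRM ?powR_ge0 ?fine_ge0// -powRrM mulfV ?gt_eqF// powRr1 ?(ltW (h0 n))//.
    by rewrite mulrC.
  exists (C * expR C / w t) => n.
  rewrite mulrAC ler_pdivlMr//.
  have nw0 : 0 <= Normc.normc (d n t) * w t by rewrite mulr_ge0 ?normc_ge0 ?ltW.
  have hle1 : (1 / 2) ^+ n <= 1 :> R by rewrite exprn_ile1//; lra.
  have ellC1 : ell (d n) t <= C.
    by apply: (le_trans (ellC n)); rewrite ler_piMr.
  apply: (le_trans (le_expR_ln1D nw0 ellC1)).
  by rewrite mulrAC ler_wpM2r ?expR_ge0.
have [_ _ w0] := hw.
(* Defining the limit through limsups of the real and imaginary parts makes it measurable on the
   whole circle, including the null set where convergence may fail. *)
exists (fun t => (fine (limn_esup (fun n => (complex.Re (f_ n t))%:E)) +i*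
                  fine (limn_esup (fun n => (complex.Im (f_ n t))%:E)))%C).
  split; apply: (measurableT_comp (fine_measurable measurableT));
    apply: measurable_fun_limn_esup => n; apply/measurable_EFinP;
    by have [] := mf_ n.
apply: filterS2 w0 (integrable_ae (@measurable_circle R) IS) => t + + tD.
move=> /(_ tD) wt /(_ tD) /(incr t tD wt)[K dK].
have cRe : cvgn (fun n => complex.Re (f_ n t)).
  apply: (@cvg_geometric_increments _ _ K) => n.
  apply: le_trans (dK n); apply: le_trans (normc_ge_Re_Im _).1.
  by rewrite /d !fctE; case: (f_ n.+1 t) (f_ n t) => ? ? [].
have cIm : cvgn (fun n => complex.Im (f_ n t)).
  apply: (@cvg_geometric_increments _ _ K) => n.
  apply: le_trans (dK n); apply: le_trans (normc_ge_Re_Im _).2.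
  by rewrite /d !fctE; case: (f_ n.+1 t) (f_ n t) => ? ? [].
rewrite (fine_limn_esup cRe) (fine_limn_esup cIm).
set x := limn _ in cRe *; set y := limn _ in cIm *.
have cr : `|complex.Re (f_ n t) - x| @[n --> \oo] --> (0 : R).
  by rewrite -(@normr0 _ R); apply: cvg_norm; apply/subr_cvg0.
have ci : `|complex.Im (f_ n t) - y| @[n --> \oo] --> (0 : R).
  by rewrite -(@normr0 _ R); apply: cvg_norm; apply/subr_cvg0.
have cri : `|complex.Re (f_ n t) - x| + `|complex.Im (f_ n t) - y| @[n --> \oo]
    --> (0 : R) by have := cvgD cr ci; rewrite addr0; apply.
have cst0 : (0 : R) @[n --> \oo] --> (0 : R) by exact: cvg_cst.
apply: (squeeze_cvgr _ cst0 cri); apply: nearW => n.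
rewrite normc_ge0/=; apply: le_trans (normc_le_ReIm _) _.
by case: (f_ n t).
Qed.

Lemma log_int_complete (f_ : nat -> lebR R -> R[i]^o) :
  (forall n, cmeasurable (f_ n)) ->
  (forall e, 0 < e -> exists N, forall n m, (N <= n)%N -> (N <= m)%N ->
    (J (f_ n - f_ m)%R <= e%:E)%E) ->
  exists2 f, cmeasurable f & forall e, 0 < e -> exists N, forall n, (N <= n)%N ->
    (J (f - f_ n)%R <= e%:E)%E.
Proof.
move=> mf_ fJ; pose del n : R := ((1 / 2) ^+ n) `^ p * (1 / 2) ^+ n.+1.
have del0 n : 0 < del n.
  by rewrite mulr_gt0 ?powR_gt0 ?exprn_gt0//; lra.
have /choice[N HN] n := fJ _ (del0 n).
(* The sum makes [phi] nondecreasing with [phi n >= N n]; the summand n gives [phi n >= n]. *)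
pose phi n := (n + \sum_(i < n.+1) N i)%N.
have phi1 n : (phi n <= phi n.+1)%N.
  by rewrite leq_add// [leqRHS]big_ord_recr leq_addr.
have phiN n : (N n <= phi n)%N by rewrite /phi big_ord_recr/= addnA leq_addl.
have [||f mf f_f] := log_int_fast_cauchy_cvg (f_ := f_ \o phi).
- by move=> n; exact: mf_.
- by move=> n; apply: HN => //; exact: leq_trans (phi1 n).
exists f => // e e0; have [M HM] := fJ _ e0; exists M => n Mn.
(* For fixed n >= M, f - f_n is the a.e. limit in j of these differences. The shift by M puts every
   index [phi (j + M)] beyond M, so that the bound e holds for all j. *)
apply: (@log_int_fatou (fun j => f_ (phi (j + M)%N) - f_ n)).
- by move=> j; exact: cmeasurableB.
- exact: cmeasurableB.
- apply: filterS f_f => t + tD => /(_ tD); rewrite -(cvg_shiftn M)/=.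
  apply: cvg_trans; apply: near_eq_cvg; apply: nearW => j /=.
  by rewrite !fctE opprB addrA subrK.
- by move=> j; apply: HM => //; rewrite (leq_trans (leq_addl j M))// leq_addr.
Qed.

(** * Stability of finiteness of J under the vector space operations *)

Lemma log_intZ_lty a f : cmeasurable f -> (J f < +oo)%E ->
  (J (a *: f)%R < +oo)%E.
Proof.
move=> mf Jf.
apply: le_lt_trans (log_intZ_le (n := Num.bound (Normc.normc a)) _ mf) _.
  by apply/ltW/archi_boundP; exact: normc_ge0.
by rewrite lte_mul_pinfty// lee_fin powR_ge0.
Qed.

(** As q > 0, finiteness can be read off the q-th power, for which the triangle inequality holds. *)
Lemma poweR_log_int_lty f : (J f `^ q < +oo)%E = (J f < +oo)%E.
Proof.
have J0 : (0 <= J f)%E by exact: log_int_ge0.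
case: (J f) J0 => [r _|_|//]; first by rewrite poweR_EFin !ltry.
by rewrite poweRyr// gt_eqF.
Qed.

Lemma log_intD_lty f g : cmeasurable f -> cmeasurable g ->
  (J f < +oo)%E -> (J g < +oo)%E -> (J (f + g)%R < +oo)%E.
Proof.
move=> mf mg Jf Jg; rewrite -poweR_log_int_lty.
by apply: le_lt_trans (log_intD_le mf mg) _; rewrite lte_add_pinfty ?poweR_log_int_lty.
Qed.

Lemma log_intB_lty f g : cmeasurable f -> cmeasurable g ->
  (J f < +oo)%E -> (J g < +oo)%E -> (J (f - g)%R < +oo)%E.
Proof.
move=> mf mg Jf Jg; rewrite -scaleN1r; apply: log_intD_lty mf _ Jf _.
- exact: cmeasurableZ.
- exact: log_intZ_lty.
Qed.

(** * Passage to classes modulo a.e. equality *)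

Lemma pi_ae0 : \pi_(ae_class R) (0 : lebR R -> R[i]^o) = 0.
Proof.
have H := pi_aeD (0 : lebR R -> R[i]^o) 0; rewrite addr0 in H.
by apply: (addrI (\pi_(ae_class R) 0)); rewrite H addr0.
Qed.

Lemma pi_aeZ a f : a *: \pi_(ae_class R) f = \pi_(ae_class R) (a *: f).
Proof. exact: pi_ae_scale. Qed.

Lemma pi_aeB f g :
  \pi_(ae_class R) f - \pi_(ae_class R) g = \pi_(ae_class R) (f - g).
Proof.
have -> : - \pi_(ae_class R) g = \pi_(ae_class R) (- g).
  by rewrite -(scaleN1r (\pi_(ae_class R) g)) pi_aeZ (scaleN1r g).
exact: pi_aeD.
Qed.

Lemma Lwp_submod_closed : submod_closed (Lwp p w).
Proof.
split.
  apply/asboolP; exists 0; split.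
  - exact: esym pi_ae0.
  - exact: cmeasurable_cst0.
  - by rewrite log_int0 ltry.
move=> a c c' /asboolP[f [-> mf Jf]] /asboolP[g [-> mg Jg]].
have maf := cmeasurableZ a mf.
apply/asboolP; exists (a *: f + g); split.
- by rewrite pi_aeZ pi_aeD.
- exact: cmeasurableD.
- exact: log_intD_lty maf mg (log_intZ_lty a mf Jf) Jg.
Qed.

(** * The metric on the space of classes *)

Context (HS : submod_closed (Lwp p w)).
Local Notation V := (sub_lmod HS).
Local Notation dist := (@rho R p w HS).

Lemma Lwp_repr (x : V) : exists f,
  [/\ val x = \pi_(ae_class R) f, cmeasurable f & (J f < +oo)%E].
Proof. exact: asboolW (valP x). Qed.

Lemma Lwp_mk f : cmeasurable f -> (J f < +oo)%E ->
  exists x : V, val x = \pi_(ae_class R) f.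
Proof.
move=> mf Jf.
have Lf : Lwp p w (\pi_(ae_class R) f) by apply/asboolP; exists f.
by exists (Sub _ Lf); rewrite SubK.
Qed.

(** The bridge from classes to functions: the distance may be computed with any measurable
    representatives, and the exponents 1/p and min(p, 1) combine into q. *)
Lemma rhoE (x y : V) f g :
  val x = \pi_(ae_class R) f -> val y = \pi_(ae_class R) g ->
  cmeasurable f -> cmeasurable g -> (J f < +oo)%E -> (J g < +oo)%E ->
  ((dist x y)%:E = J (f - g)%R `^ q)%E.
Proof.
move=> xf yg mf mg Jf Jg.
have mfg := cmeasurableB mf mg.
have xyfg : val (x - y) = \pi_(ae_class R) (f - g).
  have -> : val (x - y) = val x - val y by exact: raddfB.
  by rewrite xf yg pi_aeB.
have Jfg : J (f - g) \is a fin_num.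
  rewrite ge0_fin_numE; first exact: log_intB_lty mf mg Jf Jg.
  exact: log_int_ge0.
rewrite /rho /log_norm xyfg (log_int_repr p hw mfg) -powRrM.
by rewrite -poweR_EFin (fineK Jfg).
Qed.

Lemma rho_is_metric : is_metric dist.
Proof.
split=> [x|x y|x y|y x z].
- have [f [xf mf Jf]] := Lwp_repr x.
  apply: EFin_inj; rewrite (rhoE xf xf mf mf Jf Jf) subrr log_int0.
  by rewrite poweR0r// gt_eqF.
- have [f [xf mf Jf]] := Lwp_repr x; have [g [yg mg Jg]] := Lwp_repr y.
  move=> xy0; have J0 : J (f - g) = 0%E.
    apply: (@poweR_eq0_eq0 _ _ q); first exact: log_int_ge0.
    by rewrite -(rhoE xf yg mf mg Jf Jg) xy0.
  have fg := log_int_eq0 (cmeasurableB mf mg) J0.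
  apply: val_inj; rewrite xf yg; apply/pi_aeP.
  apply: filterS fg => t + tD => /(_ tD); rewrite !fctE => /eqP.
  by rewrite subr_eq0 => /eqP.
- have [f [xf mf Jf]] := Lwp_repr x; have [g [yg mg Jg]] := Lwp_repr y.
  have E1 := rhoE xf yg mf mg Jf Jg.
  have E2 := rhoE yg xf mg mf Jg Jf.
  have E3 : J (f - g) = J (g - f).
    by rewrite -(opprB g f); exact: (log_intN (g - f)).
  apply: EFin_inj.
  exact: (etrans E1 (etrans (congr1 (fun z => z `^ q)%E E3) (esym E2))).
- have [f [xf mf Jf]] := Lwp_repr x; have [g [yg mg Jg]] := Lwp_repr y.
  have [h [zh mh Jh]] := Lwp_repr z.
  (* Not a rewrite with rhoE: matching one distance against another unfolds both. *)
  have le_rewrite (a b c a' b' c' : \bar R) :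
      a = a' -> b = b' -> c = c' -> (a' <= b' + c' -> a <= b + c)%E.
    by move=> -> -> ->.
  rewrite -lee_fin EFinD; apply: (le_rewrite _ _ _ _ _ _
    (rhoE xf zh mf mh Jf Jh) (rhoE xf yg mf mg Jf Jg) (rhoE yg zh mg mh Jg Jh)).
  have -> : f - h = (f - g) + (g - h) by rewrite addrA subrK.
  exact: log_intD_le (cmeasurableB mf mg) (cmeasurableB mg mh).
Qed.

Lemma rho_translation (x y z : V) : dist (x + z) (y + z) = dist x y.
Proof.
have xyz : x + z - (y + z) = x - y by rewrite opprD addrACA subrr addr0.
exact: (congr1 (fun v => log_norm p w (val v) `^ Num.min p 1) xyz).
Qed.

(** The q-th power of [log_intZ_le]: one Lipschitz constant serves all scalars of modulus at most n,
    as joint continuity requires. *)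
Lemma rhoZ_le (a : R[i]) n (x y : V) : Normc.normc a <= n%:R ->
  dist (a *: x) (a *: y) <= (n%:R `^ p) `^ q * dist x y.
Proof.
move=> an; have [f [xf mf Jf]] := Lwp_repr x; have [g [yg mg Jg]] := Lwp_repr y.
have axf : val (a *: x) = \pi_(ae_class R) (a *: f) by rewrite linearZ/= xf pi_aeZ.
have ayg : val (a *: y) = \pi_(ae_class R) (a *: g) by rewrite linearZ/= yg pi_aeZ.
have maf := cmeasurableZ a mf; have mag := cmeasurableZ a mg.
have Jaf := log_intZ_lty a mf Jf; have Jag := log_intZ_lty a mg Jg.
have le_rewrite (x1 x2 y1 y2 c : \bar R) :
    x1 = y1 -> x2 = y2 -> (y1 <= c * y2 -> x1 <= c * x2)%E by move=> -> ->.
rewrite -lee_fin EFinM; apply: (le_rewrite _ _ _ _ _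
  (rhoE axf ayg maf mag Jaf Jag) (rhoE xf yg mf mg Jf Jg)).
rewrite -poweR_EFin -poweRM; first last.
- exact: log_int_ge0.
- by rewrite lee_fin powR_ge0.
have mfg := cmeasurableB mf mg.
apply: gt0_ler_poweR; first exact: ltW.
- by rewrite in_itv/= leey log_int_ge0.
- by rewrite in_itv/= leey mule_ge0 ?log_int_ge0 ?lee_fin ?powR_ge0.
- by rewrite -scalerBr; exact: log_intZ_le an mfg.
Qed.

(** J depends monotonically on the modulus, so the single sequence J(f / (n+1)) -> 0 controls J((a -
    b)f) for all close a and b. *)
Lemma rho_scale_small (x : V) (e : R) : 0 < e ->
  exists n : nat, forall a b : R[i], Normc.normc (a - b) <= n.+1%:R^-1 ->
  dist (a *: x) (b *: x) < e.
Proof.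
move=> e0; have [f [xf mf Jf]] := Lwp_repr x.
(* The threshold e^(1/q) for J corresponds to e for the metric J^q. *)
have ed : 0 < e `^ q^-1 by rewrite powR_gt0.
have := log_int_scale_cvg0 mf Jf.
move=> /fine_cvgP[_ /cvgr0Pnorm_lt/(_ _ ed)[n _ /(_ n (leqnn n))/= Hn]].
exists n => a b ab.
have axf : val (a *: x) = \pi_(ae_class R) (a *: f) by rewrite linearZ/= xf pi_aeZ.
have bxf : val (b *: x) = \pi_(ae_class R) (b *: f) by rewrite linearZ/= xf pi_aeZ.
have ms : cmeasurable ((n.+1%:R^-1)%:C%C *: f) by exact: cmeasurableZ.
have mab : cmeasurable ((a - b) *: f) by exact: cmeasurableZ.
have JS : (J ((n.+1%:R^-1)%:C%C *: f)%R < (e `^ q^-1)%:E)%E.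
  move: Hn; rewrite ger0_norm ?fine_ge0 ?log_int_ge0// -lte_fin fineK//.
  rewrite ge0_fin_numE; first exact: log_intZ_lty _ mf Jf.
  exact: log_int_ge0.
have Jab : (J ((a - b) *: f)%R < (e `^ q^-1)%:E)%E.
  apply: le_lt_trans JS; apply: log_int_mono mab ms _ => t _.
  have -> : ((a - b) *: f) t = (a - b) * f t :> R[i] by [].
  have -> : ((n.+1%:R^-1)%:C%C *: f) t = (n.+1%:R^-1)%:C%C * f t :> R[i] by [].
  rewrite !Normc.normcM ler_wpM2r ?normc_ge0//.
  by rewrite [leRHS]/= expr0n/= addr0 sqrtr_sqr ger0_norm.
rewrite -lte_fin (rhoE axf bxf (cmeasurableZ a mf) (cmeasurableZ b mf)
  (log_intZ_lty a mf Jf) (log_intZ_lty b mf Jf)).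
rewrite -scalerBl.
have -> : e = (e `^ q^-1) `^ q by rewrite -powRrM mulVf ?gt_eqF// powRr1// ltW.
have J0 : (0 <= J ((a - b) *: f)%R)%E by exact: log_int_ge0.
case: (J _) Jab J0 => [r|//|//]; rewrite lte_fin lee_fin poweR_EFin lte_fin => re r0.
by rewrite gt0_ltr_powR ?nnegrE// ltW.
Qed.

Lemma rho_complete (u : nat -> V) :
  (forall e, 0 < e -> exists N, forall n m, (N <= n)%N -> (N <= m)%N ->
    dist (u n) (u m) < e) ->
  exists l : V, forall e, 0 < e -> exists N, forall n, (N <= n)%N ->
    dist l (u n) < e.
Proof.
move=> uC; have /choice[f_ Hf] n := Lwp_repr (u n).
have mf n : cmeasurable (f_ n) by have [] := Hf n.
have uf n : val (u n) = \pi_(ae_class R) (f_ n) by have [] := Hf n.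
have Jf n : (J (f_ n) < +oo)%E by have [] := Hf n.
have [//|e e0|f mf' fJ] := @log_int_complete f_.
  (* Since the metric is J^q, a distance below e^q means J below e. *)
  have [N HN] := uC (e `^ q) (powR_gt0 _ e0); exists N => n m Nn Nm.
  move: (HN n m Nn Nm); rewrite -lte_fin (rhoE (uf n) (uf m) (mf n) (mf m) (Jf n) (Jf m)).
  have J0 : (0 <= J (f_ n - f_ m)%R)%E by exact: log_int_ge0.
  case: (J _) J0 => [r||//]; last by rewrite poweRyr// gt_eqF.
  rewrite !lee_fin poweR_EFin lte_fin => r0; apply: contraTT; rewrite -!ltNge -leNgt.
  by move=> er; rewrite ge0_ler_powR ?nnegrE// ltW.
have Jfl : (J f < +oo)%E.
  have [N /(_ N (leqnn N)) HN] := fJ 1 ltr01.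
  (* The limit is f = (f - f_N) + f_N with J(f - f_N) <= 1, hence lies in the space. *)
  rewrite -(subrK (f_ N) f); apply: log_intD_lty (cmeasurableB mf' (mf N)) (mf N) _ (Jf N).
  by rewrite (le_lt_trans HN) ?ltry.
have [l lf] := Lwp_mk mf' Jfl; exists l => e e0.
(* Completeness for J gives only a weak inequality; aiming at e/2 makes the final one strict. *)
have e20 : 0 < e / 2 by rewrite divr_gt0.
have [N HN] := fJ _ (powR_gt0 q^-1 e20); exists N => n Nn.
rewrite -lte_fin (rhoE lf (uf n) mf' (mf n) Jfl (Jf n)).
apply: (@le_lt_trans _ _ (e / 2)%:E); last by rewrite lte_fin; lra.
have -> : e / 2 = ((e / 2) `^ q^-1) `^ q.
  by rewrite -powRrM mulVf ?gt_eqF// powRr1// ltW.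
rewrite -poweR_EFin; apply: gt0_ler_poweR; first exact: ltW.
- by rewrite in_itv/= leey log_int_ge0.
- by rewrite in_itv/= leey lee_fin powR_ge0.
- exact: HN.
Qed.

End LogIntegral.

(* Verification of the F-space axioms *)
Local Close Scope classical_set_scope.

Theorem theorem6p2 (R : realType) (p : R) (hp : 0 < p) (w : lebR R -> R)
    (hw : is_weight w) :
  exists HS : submod_closed (Lwp p w), F_space (@rho R p w HS).
Proof.
have HS := Lwp_submod_closed hp hw; exists HS.
have Hd := rho_is_metric hp hw HS; exists Hd => E.
have trD := rho_translation (HS := HS).
have scale := rhoZ_le hp hw (HS := HS); have small := rho_scale_small hp hw (HS := HS).
have complete := rho_complete hp hw (HS := HS).
(* The metric becomes an abstract [d]: the axioms follow from its translation invariance, the two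
   scaling estimates and sequential completeness. *)
move: (@rho R p w HS) Hd @E trD scale small complete => d Hd E trD scale small complete.
have ballE (x y : E) e : ball x e y = (d x y < e) by [].
have nb (x : E) e : 0 < e -> nbhs x (ball x e) by exact: nbhsx_ballx.
split.
- exact: trD.
- move=> u /cauchy_ballP uC.
  have [e e0|l Hl] := complete u.
    have [[A B] /= [[N1 _ HA] [N2 _ HB]] AB] := uC e e0.
    exists (maxn N1 N2) => n m; rewrite !geq_max => /andP[n1 _] /andP[_ m2].
    by apply: (AB (u n, u m)); split => /=; [exact: HA|exact: HB].
  exists l; apply/cvg_ballP => e e0.
  by have [N HN] := Hl e e0; exists N => // n /= Nn; rewrite ballE; exact: HN.
- move=> [x y]; apply/cvg_ballP => e e0.
  have e20 : 0 < e / 2 by rewrite divr_gt0.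
  exists (ball (x : E) (e / 2), ball (y : E) (e / 2)).
    by split => /=; exact: nb.
  move=> [x' y'] /= [xx' yy']; rewrite ballE.
  (* Passing through x' + y changes one summand at a time, and translation invariance removes the
     other. *)
  apply: (le_lt_trans (is_metric_triangle Hd (x' + y) _ _)).
  rewrite trD (addrC x' y) (addrC x' y') trD (splitr e).
  exact: ltrD.
- move=> [a x]; apply/cvg_ballP => e e0.
  (* This n bounds |b| for every b within distance 1 of a, and C is the Lipschitz constant of
     [rhoZ_le] for such b. Dividing by C + 1 below keeps the divisor positive. *)
  pose n := Num.bound (Normc.normc a + 1).
  pose C := (n%:R `^ p) `^ (p^-1 * Num.min p 1).
  have C0 : 0 <= C by exact: powR_ge0.
  have e20 : 0 < e / 2 by rewrite divr_gt0.
  have e2C0 : 0 < e / 2 / (C + 1) by rewrite divr_gt0// ltr_wpDl.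
  have [m Hm] := small x _ e20.
  exists (ball (a : R[i]^o) (m.+1%:R^-1)%:C%C, ball (x : E) (e / 2 / (C + 1))).
    split => /=; last exact: nb.
    by apply: (nbhsx_ballx (a : R[i]^o)); rewrite ltcR.
  move=> [b y] /= [ab xy]; rewrite ballE.
  have {}ab : Normc.normc (a - b) < m.+1%:R^-1 by rewrite -ltcR.
  (* Through b x: first the scalar moves with the vector x fixed ([small]), then the vector moves
     under a scalar of bounded modulus ([scale]). *)
  apply: (le_lt_trans (is_metric_triangle Hd (b *: (x : E)) _ _)).
  rewrite (splitr e); apply: ltr_leD; first by apply: Hm; exact: ltW.
  have bn : Normc.normc b <= n%:R.
    apply/ltW; apply: le_lt_trans (archi_boundP _); last first.
      by rewrite addr_ge0 ?normc_ge0.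
    have -> : b = a + (b - a) by rewrite addrCA subrr addr0.
    apply: le_trans (normcD_le _ _) _; rewrite lerD2l.
    rewrite -opprB normcN; apply: (le_trans (ltW ab)).
    by rewrite invf_le1// ler1n.
  apply: (le_trans (scale b n x y bn)).
  apply: (@le_trans _ _ (C * (e / 2 / (C + 1)))).
    by rewrite ler_wpM2l// ltW.
  rewrite mulrA ler_pdivrMr ?ltr_wpDl// mulrC ler_wpM2l ?ltW//.
  by rewrite ltr_pwDr.
Qed.
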